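(* Let $G$ be a pertinent group of order $2^nd$ with $d$ odd and $n\geq 2$. Then $n$ is even.
   Context: A finite group is pertinent if it has exactly three involutions and these three involutions are pairwise conjugate in the group. *)

(* Defs.v *)
From mathcomp Require Import all_boot all_fingroup.

Set Implicit Arguments.
Unset Strict Implicit.
Unset Printing Implicit Defensive.

Local Open Scope group_scope.

Definition involutions (gT : finGroupType) (G : {set gT}) : {set gT} :=
  [set x in G | #[x] == 2].

Definition pertinent (gT : finGroupType) (G : {set gT}) : Prop :=
  #|involutions G| = 3 /\
  {in involutions G &, forall x y, y \in x ^: G}.

(* Main.v *)
Require Import Defs.
From mathcomp Require Import all_boot all_fingroup all_solvable.
Set Implicit Arguments.
Unset Strict Implicit.
Unset Printing Implicit Defensive.

Local Open Scope group_scope.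

(** Let [I] be the set of the three involutions of [G] and [C = 'C_G(I)].
    Then [G / C] has order 3 or 6, so 4 dividing [#|G|] makes [#|C|] even:
    some involution commutes with all the others, hence by conjugacy all
    involutions commute. A 3-subgroup [A] of [G] outside [C] permutes [I]
    transitively, and then no involution normalizes [A], so [#|'N_G(A)|] is
    odd. If [G / C] had order 6, the Frattini argument for a Sylow 3-subgroup
    [A] of [G] inside the subgroup [C A] of index 2 would make [#|'N_G(A)|]
    even; so [#|G : C| = 3]. Then a Sylow 2-subgroup [Q] of [C] is one of [G],
    and by the Frattini argument again it is normalized by a 3-group outside
    [C], which has 1 as only fixed point on [Q]. Hence [2 ^ n = #|Q|] is
    congruent to 1 modulo 3. *)

(** Modulo 3, 4 is 1, so an odd [n] would give 2. *)
Lemma expn2_mod3_even (n : nat) : 2 ^ n = 1 %[mod 3] -> ~~ odd n.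
Proof.
apply: contra_eqN; rewrite -{2}[n]odd_double_half => ->.
by rewrite expnD -mul2n expnM -modnMmr -modnXm exp1n.
Qed.

Lemma mem_cent1J (gT : finGroupType) (x g : gT) : (g \in 'C[x]) = (x ^ g == x).
Proof.
rewrite cent1C.
by apply/cent1P/eqP => [cxg | /conjg_fixP/commgP //]; apply/conjg_fixP/commgP.
Qed.

Lemma mem_involutionsJ (gT : finGroupType) (G : {group gT}) (x g : gT) :
  g \in G -> (x ^ g \in involutions G) = (x \in involutions G).
Proof. by move=> Gg; rewrite !inE groupJr // orderJ. Qed.

Lemma acts_involutions (gT : finGroupType) (G H : {group gT}) :
  H \subset G -> [acts H, on involutions G | 'J].
Proof.
move=> sHG; apply/actsP=> g Hg x; exact: mem_involutionsJ (subsetP sHG g Hg).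
Qed.

Lemma cent_involutions_normal (gT : finGroupType) (G : {group gT}) :
  'C_G(involutions G) <| G.
Proof.
have := subcent_normal G (involutions G); congr (_ <| _).
by apply/setIidPl; have := acts_involutions (subxx G); rewrite astabsJ.
Qed.

Lemma odd_card_no_involution (gT : finGroupType) (G H : {group gT}) :
  H \subset G -> {in involutions G, forall x, x \notin H} -> odd #|H|.
Proof.
move=> sHG noI; apply: contraT; rewrite -dvdn2 => /(Cauchy _).
case=> // x Hx ox; suff /noI : x \in involutions G by rewrite Hx.
by rewrite inE (subsetP sHG) //= ox.
Qed.

(** By Frattini, [G] is the product of [L] and ['N_G(P)]. The index counts cosets of [L] meeting
    ['N_G(P)]; [L] need not lie inside. *)
Lemma index_Frattini (gT : finGroupType) (p : nat) (G L P : {group gT}) :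
  L <| G -> p.-Sylow(L) P -> #|'N_G(P) : L| = #|G : L|.
Proof. by move=> nLG sylP; rewrite -{2}(Frattini_arg nLG sylP) indexMg. Qed.

(** The image of [P] in [G / L] is a Sylow subgroup there. *)
Lemma index_Sylow_normal (gT : finGroupType) (p : nat) (G L P : {group gT}) :
  L <| G -> p.-Sylow(G) P -> #|P : L| = (#|G : L|`_p)%N.
Proof.
move=> nLG sylP; have nLP := subset_trans (pHall_sub sylP) (normal_norm nLG).
rewrite -!card_quotient ?(normal_norm nLG) //.
by apply: card_Hall; apply: quotient_pHall.
Qed.

(** By transitivity the stabilizer of [x] has index 3; in it [y] has at most 2 conjugates, and
    fixing [x] and [y] fixes the third involution. *)
Lemma pertinent_index_cent (gT : finGroupType) (G : {group gT}) :
  pertinent G -> #|G : 'C_G(involutions G)| \in [:: 3; 6].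
Proof.
case=> cI trI; set I := involutions G in cI trI *.
have /card_gt0P[x Ix] : 0 < #|I| by rewrite cI.
have cIx : #|I :\ x| = 2 by move: cI; rewrite (cardsD1 x) Ix => -[].
have /card_gt0P[y Ixy] : 0 < #|I :\ x| by rewrite cIx.
have /eqP/cards1P[z Iz] : #|I :\ x :\ y| = 1%N.
  by move: cIx; rewrite (cardsD1 y) Ixy => -[].
have /setD1P[nyx Iy] := Ixy.
have oxG : #|G : 'C_G[x]| = 3.
  rewrite index_cent1 -cI; congr #|pred_of_set _|.
  apply/setP=> u; apply/idP/idP.
    by case/imsetP=> g Gg ->; rewrite mem_involutionsJ.
  exact: trI.
have oyC : #|'C_G[x] : 'C_('C_G[x])[y]| <= 2.
  rewrite index_cent1 -cIx subset_leq_card //; apply/subsetP=> u.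
  case/imsetP=> g /setIP[Gg]; rewrite mem_cent1J => /eqP cxg ->.
  rewrite 2!inE mem_involutionsJ // Iy andbT -[x in _ != x]cxg.
  by rewrite (inj_eq (conjg_inj g)).
have defC : 'C_('C_G[x])[y] = 'C_G(I).
  apply/eqP; rewrite eqEsubset -setIA; apply/andP; split; last first.
    by rewrite setIS // subsetI -!cent_set1 !centS // sub1set.
  apply/subsetP=> g /setIP[Gg /setIP[cxg cyg]].
  rewrite inE Gg -sub_cent1; apply/subsetP=> u Iu; rewrite cent1C.
  have [-> //|nux] := eqVneq u x; have [-> //|nuy] := eqVneq u y.
  move: cxg cyg; rewrite !mem_cent1J => /eqP cxg /eqP cyg.
  have eqz v : v \in I :\ x :\ y -> v = z by rewrite Iz => /set1P.
  have Iug : u ^ g \in I :\ x :\ y.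
    rewrite !in_setD1 mem_involutionsJ // Iu andbT -{1}cyg -{1}cxg.
    by rewrite !(inj_eq (conjg_inj g)) nuy.
  by rewrite (eqz _ Iug) (eqz u) // !in_setD1 nuy nux.
have sC : 'C_('C_G[x])[y] \subset 'C_G[x] by apply: subsetIl.
rewrite -defC -(Lagrange_index (subsetIl _ _) sC) oxG.
by case: #|_ : _| (indexg_gt0 'C_G[x] 'C_('C_G[x])[y]) oyC => [|[|[|?]]].
Qed.

Lemma pertinent_commute (gT : finGroupType) (G : {group gT}) :
  pertinent G -> 4 %| #|G| -> {in involutions G &, forall x y, commute x y}.
Proof.
move=> pG; have [_ trI] := pG.
rewrite -(Lagrange (subsetIl G 'C(involutions G))) => d4.
have : 2 %| #|'C_G(involutions G)|.
  move: (pertinent_index_cent pG) d4; rewrite !inE => /orP[]/eqP->.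
    by rewrite Gauss_dvdl // => /(dvdn_trans _); apply.
  by rewrite -[4]/(2 * 2)%N -[6]/(3 * 2)%N mulnA dvdn_pmul2r // Gauss_dvdl.
case/Cauchy=> // w /setIP[Gw /centP cIw] ow x y Ix Iy.
have Iw : w \in involutions G by rewrite inE Gw ow.
have /imsetP[g Gg ->] := trI _ _ Iw Ix.
(* Conjugating back by [g] leaves only that [w] commutes with [y ^ g^-1]. *)
rewrite -(conjgKV g y) /commute -!conjMg; congr (_ ^ g).
by apply: cIw; rewrite mem_involutionsJ ?groupV.
Qed.

(* An involution [w] normalizing [A] centralizes it: [[~ w, a]] lies in [A],
   and squares to 1 since it is the product of the commuting involutions
   [w] and [w ^ a]. *)
Lemma odd_norm_3group (gT : finGroupType) (G A : {group gT}) :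
    pertinent G -> 4 %| #|G| -> A \subset G -> 3.-group A ->
    ~~ (A \subset 'C_G(involutions G)) ->
  odd #|'N_G(A)|.
Proof.
move=> pG d4 sAG pA; have [cI _] := pG; rewrite subsetI sAG => nCA.
apply: (@odd_card_no_involution _ G); first exact: subsetIl.
move=> w Iw; apply: contra nCA => /setIP[Gw nAw].
have cAw : w \in 'C(A).
  apply/centP=> a Aa; apply/commgP; rewrite -order_eq1 -dvdn1.
  have /eqP <- : coprime 2 #|A|.
    by rewrite coprime_sym; apply: (@pnat_coprime 3).
  rewrite dvdn_gcd order_dvdn order_dvdG ?andbT; last first.
    by rewrite commgEr groupM // ?memJ_norm ?groupV.
  have Ga := subsetP sAG a Aa.
  have cww := pertinent_commute pG d4 Iw (etrans (mem_involutionsJ _ Ga) Iw).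
  have w2 : w ^+ 2 = 1.
    by move: Iw; rewrite inE => /andP[_ /eqP<-]; apply: expg_order.
  rewrite commgEl expgMn; last by apply/commute_sym/commuteV/commute_sym.
  by rewrite expgVn -conjXg w2 invg1 conj1g mulg1.
(* The number of involutions fixed by [A] is a multiple of 3, and [w] is one of them, so all three
   are fixed. *)
have := pgroup_fix_mod pA (acts_involutions sAG); rewrite cI afixJ => fixI.
have defI : involutions G :&: 'C(A) = involutions G.
  apply/eqP; rewrite eqEcard subsetIl cI dvdn_leq //.
    by apply/card_gt0P; exists w; rewrite inE Iw.
  by rewrite /dvdn -fixI.
by rewrite centsC -defI subsetIr.
Qed.

Lemma pertinent_index_cent_neq6 (gT : finGroupType) (G : {group gT}) :
  pertinent G -> 4 %| #|G| -> #|G : 'C_G(involutions G)| <> 6.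
Proof.
move=> pG d4 i6; set C := ('C_G(involutions G))%G in i6.
have nCG : C <| G := cent_involutions_normal G.
have [A sylA] := Sylow_exists 3 G; have [sAG pA _] := and3P sylA.
have nCA : A \subset 'N(C) := subset_trans sAG (normal_norm nCG).
have sLG : C <*> A \subset G by rewrite join_subG normal_sub.
have sCL : C \subset C <*> A := joing_subl C A.
have iL : #|C <*> A : C| = 3.
  by rewrite norm_joinEr // indexMg (index_Sylow_normal nCG sylA) i6 p_part.
have i2 : #|G : C <*> A| = 2.
  by apply/eqP; rewrite -(eqn_pmul2r (isT : 0 < 3)) -{1}iL Lagrange_index ?i6.
have nLG := index2_normal sLG i2.
have sylAL := pHall_subl (joing_subr C A) sLG sylA.
(* By Frattini ['N_G(A)] meets both cosets of [C <*> A], so its order is even. *)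
have : odd #|'N_G(A)|; last first.
  rewrite -(LagrangeI 'N_G(A) (C <*> A)) (index_Frattini nLG sylAL) i2.
  by rewrite oddM andbF.
apply: odd_norm_3group => //; apply: contra_eqN iL => sAC.
by rewrite (joing_idPl sAC) indexgg.
Qed.

Lemma pertinent_even_log (gT : finGroupType) (G : {group gT}) :
  pertinent G -> 4 %| #|G| -> ~~ odd (logn 2 #|G|).
Proof.
move=> pG d4; set C := ('C_G(involutions G))%G.
have nCG : C <| G := cent_involutions_normal G.
have i3 : #|G : C| = 3.
  have := pertinent_index_cent pG; rewrite !inE => /orP[]/eqP // i6.
  by case: (pertinent_index_cent_neq6 pG d4).
have [Q sylQ] := Sylow_exists 2 C; have [sQC pQ _] := and3P sylQ.
have [A sylA] := Sylow_exists 3 'N_G(Q); have [sAN pA _] := and3P sylA.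
have [sAG nQA] := subsetIP sAN.
have cQ : #|Q| = (2 ^ logn 2 #|G|)%N.
  rewrite (card_Hall sylQ) p_part -(Lagrange (normal_sub nCG)) i3.
  by rewrite lognM ?cardG_gt0 // addn0.
have nCA : ~~ (A \subset C).
  rewrite -indexg_eq1 -indexgI.
  (* Intersecting [C] with ['N_G(Q)] gives a normal subgroup of ['N_G(Q)], where [A] is Sylow; its
     index there is 3. *)
  have -> : A :&: C = A :&: ('N_G(Q) :&: C) by rewrite setIA (setIidPl sAN).
  rewrite indexgI (index_Sylow_normal _ sylA) ?(normalGI (subsetIl G _)) //.
  by rewrite indexgI (index_Frattini nCG sylQ) i3 p_part.
have oNA := odd_norm_3group pG d4 sAG pA nCA.
(* A 2-group inside the odd-order group ['N_G(A)] is trivial. *)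
have trQA : Q :&: 'C(A) = 1.
  apply/eqP; rewrite trivg_card1.
  have sD : Q :&: 'C(A) \subset 'N_G(A).
    by rewrite setISS ?cent_sub // (subset_trans sQC) ?normal_sub.
  apply/eqP/(pnat_1 (pgroupS (subsetIl Q 'C(A)) pQ)).
  by rewrite -odd_2'nat (oddSg sD).
have := pgroup_fix_mod pA (_ : [acts A, on Q | 'J]); rewrite astabsJ afixJ.
rewrite trQA cards1 cQ => /(_ nQA).
exact: expn2_mod3_even.
Qed.

Theorem theorem4p6 (gT : finGroupType) (G : {group gT}) (n d : nat)
    (hG : pertinent G) (hcard : #|G| = (2 ^ n * d)%N)
    (hd : odd d) (hn : 2 <= n) :
  ~~ odd n.
Proof.
have <- : logn 2 #|G| = n.
  rewrite hcard lognM ?expn_gt0 ?(odd_gt0 hd) // pfactorK // lognE.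
  by rewrite dvdn2 hd /= andbF addn0.
apply: pertinent_even_log => //.
by rewrite hcard dvdn_mulr // (dvdn_exp2l 2 hn).
Qed.
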